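(* Let $\mathcal{X}$ be a discrete set and let $\mathcal{A}$ be an $\varepsilon$-differentially private randomized algorithm that, given a dataset $S\in\mathcal{X}^n$, outputs a function from $\mathcal{X}$ to $[0,1]$. Let $\mathcal{P}$ be any distribution over $\mathcal{X}$, let $\mathbf{S}$ be a random variable distributed according to $\mathcal{P}^n$, and let $\boldsymbol{\phi}=\mathcal{A}(\mathbf{S})$. Then for any $\beta>0$, $\tau>0$ and $n\ge 12\ln(4/\beta)/\tau^2$, if $\varepsilon\le\tau/2$ then $$\Pr\left[\,\left|\mathcal{P}[\boldsymbol{\phi}]-\mathcal{E}_{\mathbf{S}}[\boldsymbol{\phi}]\right|>\tau\,\right]\le\beta,$$ where the probability is over the randomness of $\mathcal{A}$ and of $\mathbf{S}$.
   Context: For a function $\psi:\mathcal{X}\to[0,1]$, $\mathcal{P}[\psi]=\mathbb{E}_{x\sim\mathcal{P}}[\psi(x)]$, and for a dataset $S=(x_1,\dots,x_n)$, $\mathcal{E}_S[\psi]=\frac1n\sum_{i=1}^n\psi(x_i)$ is the empirical average. Two datasets in $\mathcal{X}^n$ are adjacent if they differ in a single element. A randomized algorithm $\mathcal{A}$ with domain $\mathcal{X}^n$ is $(\varepsilon,\delta)$-differentially private if for every set $\mathcal{S}$ of outputs and every pair of adjacent datasets $x,y$, $\Pr[\mathcal{A}(x)\in\mathcal{S}]\le e^{\varepsilon}\Pr[\mathcal{A}(y)\in\mathcal{S}]+\delta$ (probability over the coins of $\mathcal{A}$); $\varepsilon$-differentially private means $(\varepsilon,0)$-differentially private. *)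

(* Defs.v *)
From HB Require Import structures.
From mathcomp Require Import all_boot all_order all_algebra.
From mathcomp Require Import all_classical all_reals all_analysis.
Set Implicit Arguments. Unset Strict Implicit. Unset Printing Implicit Defensive.
Import Order.TTheory GRing.Theory Num.Theory.
Import numFieldNormedType.Exports.
Local Open Scope classical_set_scope.
Local Open Scope ring_scope.

(* Generating class of the product (cylinder) sigma-algebra on X -> R:
   preimages of Borel sets under the evaluation maps f |-> f x. *)
Definition eval_sets (X : Type) (R : realType) : set (set (X -> R)) :=
  [set E | exists x : X, exists B : set R, measurable B /\
           E = (fun f : X -> R => f x) @^-1` B].

Notation funspace X R := (g_sigma_algebraType (@eval_sets X R)).

Definition is_pmf (X : choiceType) (R : realType) (p : X -> R) : Prop :=
  (forall x, 0 <= p x) /\ (\esum_(x in [set: X]) (p x)%:E = 1%E).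

Definition pexp (X : choiceType) (R : realType) (p : X -> R) (psi : X -> R) : R :=
  fine (\esum_(x in [set: X]) (p x * psi x)%:E).

Definition emp_avg (X : Type) (R : realType) (n : nat) (S : n.-tuple X) (psi : X -> R) : R :=
  (n%:R)^-1 * \sum_(i < n) psi (tnth S i).

Definition adjacent (X : Type) (n : nat) (S1 S2 : n.-tuple X) : Prop :=
  exists i : 'I_n, forall j : 'I_n, j != i -> tnth S1 j = tnth S2 j.

(* eps-differential privacy ((eps,0)-DP) of a randomized algorithm whose
   output distribution on dataset S is the probability measure A S. *)
Definition eps_dp (X : Type) (R : realType) (n : nat)
  (A : n.-tuple X -> probability (funspace X R) R) (eps : R) : Prop :=
  forall S1 S2 : n.-tuple X, adjacent S1 S2 ->
  forall E : set (funspace X R), measurable E ->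
    (A S1 E <= (expR eps)%:E * A S2 E)%E.

Definition pmf_n (X : Type) (R : realType) (p : X -> R) (n : nat) (S : n.-tuple X) : R :=
  \prod_(i < n) p (tnth S i).

(* Main.v *)
Require Import Defs.
From HB Require Import structures.
From mathcomp Require Import all_boot all_order all_algebra.
From mathcomp Require Import all_classical all_reals all_analysis.
From mathcomp Require Import measurable_realfun.
From mathcomp Require Import ring lra.
Import Order.TTheory GRing.Theory Num.Theory.
Import numFieldNormedType.Exports.
Local Open Scope classical_set_scope.
Local Open Scope ring_scope.
Set Implicit Arguments.
Unset Strict Implicit.
Unset Printing Implicit Defensive.

(** Write v(x) for the value of the
    output at x and q for its P-mean.  In the joint law of (S, A(S)), resampling
    the k-th record and using privacy for 1 - v shows that the conditional mean
    of v(S_k), under any weight that ignores S_k, is at most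
    1 - exp(-eps) (1 - q) <= q + eps.  Hence each factor exp(l (v(S_k) - q))
    multiplies the joint exponential moment by at most exp(l eps + 3/4 l^2).
    Chernoff's bound with l = tau/3 and eps = tau/2 gives exp(-n tau^2/12) for
    each of the two tails, the lower one being the upper one for 1 - v. *)

(** * Elementary bounds for the exponential *)

(** A lower bound for exp(-x) suffices: 1 - x/8 <= exp(-x/8) is squared three times. *)
Lemma expR_le_quadratic (R : realType) (x : R) :
  0 <= x <= 1 / 3 -> expR x <= 1 + x + 3 / 4 * x ^+ 2.
Proof.
move=> /andP[x0 x3].
suff : 1 <= (1 + x + 3 / 4 * x ^+ 2) * expR (- x).
  by rewrite expRN ler_pdivlMr ?expR_gt0// mul1r.
have e : 1 - x / 8 <= expR (- (x / 8)) by exact: expR_ge1Dx.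
(* Lower bounds for exp(-x/8), exp(-x/4), exp(-x/2), exp(-x) in turn. *)
have -> : expR (- x) = ((expR (- (x / 8)) ^+ 2) ^+ 2) ^+ 2.
  by rewrite -!exprM -expRM_natl; congr expR; field.
set y := expR _ in e *.
have e1 : 1 - x / 4 + x ^+ 2 / 64 <= y ^+ 2 by nra.
(* Squaring gives the quadratic coefficients 3/32 here and 43/100 in [e3]; rounding them down to
   9/100 and 4/10 absorbs the cubic terms when x <= 1/3. *)
have e2 : 1 - x / 2 + 9 / 100 * x ^+ 2 <= (y ^+ 2) ^+ 2.
  have : (1 - x / 4 + x ^+ 2 / 64) ^+ 2 <= (y ^+ 2) ^+ 2.
    by rewrite lerXn2r ?nnegrE ?sqr_ge0//; nra.
  apply: le_trans; rewrite -subr_ge0.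
  rewrite (_ : _ - _ = x ^+ 2 * (3 / 800 - x / 128 + x ^+ 2 / 4096)); last by field.
  by apply: mulr_ge0; nra.
have e3 : 1 - x + 4 / 10 * x ^+ 2 <= ((y ^+ 2) ^+ 2) ^+ 2.
  have : (1 - x / 2 + 9 / 100 * x ^+ 2) ^+ 2 <= ((y ^+ 2) ^+ 2) ^+ 2.
    by rewrite lerXn2r ?nnegrE ?sqr_ge0//; nra.
  apply: le_trans; rewrite -subr_ge0.
  rewrite (_ : _ - _ = x ^+ 2 * (3 / 100 - 9 / 100 * x + 81 / 10000 * x ^+ 2)); last by field.
  by apply: mulr_ge0; nra.
apply: le_trans (_ : (1 + x + 3 / 4 * x ^+ 2) * (1 - x + 4 / 10 * x ^+ 2) <= _); last first.
  by rewrite ler_wpM2l// !addr_ge0// mulr_ge0// sqr_ge0.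
rewrite -subr_ge0.
rewrite (_ : _ - _ = x ^+ 2 * (3 / 20 - 7 / 20 * x + 3 / 10 * x ^+ 2)); last by field.
by apply: mulr_ge0; nra.
Qed.

(** Convexity: l v is the combination of l and 0 with weights v and 1 - v. *)
Lemma expR_chord (R : realType) (l v : R) :
  0 <= v <= 1 -> expR (l * v) <= 1 + (expR l - 1) * v.
Proof.
move=> /andP[v0 v1].
have := @convex_expR R (Itv01 v0 v1) l 0.
rewrite !convRE /= mulr0 addr0 expR0 mulr1 (mulrC v) => /le_trans; apply.
by rewrite /unstable.onem; lra.
Qed.

(** * Unordered sums: scaling, measurability and exchange with integrals *)

Lemma esumZl (R : realType) (T : choiceType) (r : \bar R) (a : T -> \bar R) :
  (0 <= r)%E -> (forall x, 0 <= a x)%E ->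
  (\esum_(x in [set: T]) (r * a x) = r * \esum_(x in [set: T]) a x)%E.
Proof.
move=> + a0; case: r => [r r0| _ |//]; last first.
  (* For an infinite factor, either all terms vanish or one positive term makes both sides
     infinite. *)
  have [[x ax]|na] := pselect (exists x, a x != 0%E); last first.
    have {}na x : a x = 0%E by apply: contra_notP na => /eqP ?; exists x.
    by rewrite !esum1 ?mule0// => x _; rewrite na mule0.
  have {}ax : (0 < a x)%E by rewrite lt0e ax a0.
  have single (b : T -> \bar R) : (b x <= \esum_(y in [set: T]) b y)%E.
    by apply: esum_ge; exists [set x]; [split | rewrite fsbig_set1].
  rewrite gt0_mulye ?(lt_le_trans ax)//.
  by have := single (fun x => +oo * a x)%E; rewrite gt0_mulye// leye_eq => /eqP.
rewrite /esum -ereal_supZl//; last first.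
  by apply/set0P; exists (\sum_(x \in set0) a x)%E; exists set0 => //; exact: fsets_set0.
rewrite image_comp; congr ereal_sup; apply: eq_imagel => F [finF _] /=.
by rewrite ge0_mule_fsumr.
Qed.

(** Enumerating X by [pickle], with 0 at the codes of no element, makes the theorems on series of
    measurable functions applicable. *)
Lemma esum_countType (R : realType) (X : countType) (a : X -> \bar R) :
  (forall x, 0 <= a x)%E ->
  (\esum_(x in [set: X]) a x = \sum_(i <oo) oapp a 0 (pickle_inv i))%E.
Proof.
move=> a0; rewrite nneseries_esumT; last by move=> i; case: pickle_inv => /=.
transitivity (\esum_(i in range (@pickle X)) oapp a 0%E (pickle_inv i)).
  rewrite esum_image; last by move=> x y _ _ /(pcan_inj pickleK_inv).
  by apply: eq_esum => x _; rewrite pickleK_inv.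
rewrite esum_mkcond; apply: eq_esum => i _; case: ifPn => // /negP.
rewrite inE => ni; case e: (pickle_inv i) => [x|//]; exfalso; apply: ni.
by exists x => //; have := @pickle_invK X i; rewrite e.
Qed.

(* [esum] is a supremum of finite partial sums, so on signed functions it only
   sees the positive parts; hence [pexp p] is measurable on the whole function
   space and not just on the [0,1]-valued functions. *)
Lemma esum_funepos (R : realType) (X : choiceType) (f : X -> \bar R) :
  \esum_(x in [set: X]) f x = \esum_(x in [set: X]) maxe (f x) 0%E.
Proof.
apply/eqP; rewrite eq_le; apply/andP; split.
  by apply: le_esum => x _; rewrite le_max lexx.
apply: ge_ereal_sup => _ [F [finF _] <-].
apply: ereal_sup_ubound; exists (F `&` [set x | 0 <= f x]%E).
  by split => //; exact: finite_setIl.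
rewrite fsbig_mkcondr; apply: eq_fsbigr => x _.
case: ifPn => /=; first by rewrite inE => /max_idPl.
by rewrite notin_setE => /negP; rewrite -ltNge => /ltW /max_idPr.
Qed.

Lemma measurable_fun_esum d (T : measurableType d) (R : realType) (X : countType)
    (f : X -> T -> \bar R) :
  (forall x, measurable_fun [set: T] (f x)) ->
  measurable_fun [set: T] (fun t => \esum_(x in [set: X]) f x t).
Proof.
move=> mf; under eq_fun do rewrite esum_funepos.
have m0 x t : (0 <= maxe (f x t) 0)%E by rewrite le_max lexx orbT.
under eq_fun do rewrite esum_countType//.
apply: ge0_emeasurable_sum => [k t _ _|k _]; case: pickle_inv => //= x.
exact: measurable_maxe.
Qed.

Lemma integral_esum d (T : measurableType d) (R : realType) (X : countType)
    (mu : {measure set T -> \bar R}) (f : X -> T -> \bar R) :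
  (forall x, measurable_fun [set: T] (f x)) -> (forall x t, 0 <= f x t)%E ->
  (\int[mu]_t (\esum_(x in [set: X]) f x t) = \esum_(x in [set: X]) (\int[mu]_t f x t))%E.
Proof.
move=> mf f0; rewrite esum_countType; last by move=> x; exact: integral_ge0.
under eq_integral do rewrite esum_countType//.
rewrite integral_nneseries//.
- by apply: eq_eseriesr => k _; case: pickle_inv => //=; rewrite integral0.
- by move=> k; case: pickle_inv => //=.
- by move=> k t _; case: pickle_inv => //=.
Qed.

(** The two sums add up to the total mass 1, and [q] is finite, so it can be subtracted. *)
Lemma esum_onem (R : realType) (X : choiceType) (p w : X -> R) (q : R) :
  is_pmf p -> (forall x, 0 <= w x <= 1) ->
  \esum_(x in [set: X]) (p x * w x)%:E = q%:E ->
  \esum_(x in [set: X]) (p x * (1 - w x))%:E = (1 - q)%:E.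
Proof.
move=> [p0 p1] w01 hq.
have : \esum_(x in [set: X]) ((p x * w x)%:E + (p x * (1 - w x))%:E)%E = 1%E.
  by rewrite -[RHS]p1; apply: eq_esum => x _; rewrite -EFinD; congr EFin; ring.
rewrite esumD; first by rewrite hq EFinB => <-; rewrite (addeC q%:E) addeK.
- by move=> x _; have /andP[? _] := w01 x; rewrite lee_fin mulr_ge0.
- by move=> x _; have /andP[_ ?] := w01 x; rewrite lee_fin mulr_ge0 ?subr_ge0.
Qed.

(** * The product distribution and resampling of one record *)

Definition tuple_set (X : Type) (n : nat) (S : n.-tuple X) (k : 'I_n) (x : X) :=
  [tuple if i == k then x else tnth S i | i < n].

Lemma tnth_tuple_set (X : Type) (n : nat) (S : n.-tuple X) (k i : 'I_n) (x : X) :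
  tnth (tuple_set S k x) i = if i == k then x else tnth S i.
Proof. by rewrite tnth_mktuple. Qed.

Lemma tuple_set_tuple_set (X : Type) (n : nat) (S : n.-tuple X) (k : 'I_n) (x : X) :
  tuple_set (tuple_set S k x) k (tnth S k) = S.
Proof.
by apply: eq_from_tnth => i; rewrite !tnth_tuple_set; case: eqP => // ->.
Qed.

(** Stated without division because [p (tnth S k)] may be 0. *)
Lemma pmf_n_tuple_set (R : realType) (X : choiceType) (p : X -> R) (n : nat)
    (S : n.-tuple X) (k : 'I_n) (x : X) :
  pmf_n p (tuple_set S k x) * p (tnth S k) = pmf_n p S * p x.
Proof.
rewrite /pmf_n (bigD1 k)//= [in RHS](bigD1 k)//= tnth_tuple_set eqxx.
rewrite (eq_bigr (fun i => p (tnth S i))); first by ring.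
by move=> i /negPf ik; rewrite tnth_tuple_set ik.
Qed.

Lemma pmf_n_ge0 (R : realType) (X : choiceType) (p : X -> R) (n : nat)
    (S : n.-tuple X) : is_pmf p -> 0 <= pmf_n p S.
Proof. by move=> [p0 _]; apply: prodr_ge0. Qed.

Lemma esum_esumT (R : realType) (T1 T2 : choiceType) (a : T1 -> T2 -> \bar R) :
  (forall x y, 0 <= a x y)%E ->
  \esum_(x in [set: T1]) \esum_(y in [set: T2]) a x y =
  \esum_(z in [set: T1 * T2]) a z.1 z.2.
Proof.
move=> a0; rewrite (@esum_esum _ _ _ setT (fun=> setT))//.
by congr esum; apply/seteqP.
Qed.

(* The involution (S, x) |-> (S with S_k replaced by x, S_k) preserves the
   product weight, so a fresh sample may be swapped in for the k-th one. *)
Lemma esum_resample (R : realType) (X : choiceType) (n : nat) (p : X -> R)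
    (k : 'I_n) (F : n.-tuple X -> X -> \bar R) :
  is_pmf p -> (forall S x, 0 <= F S x)%E ->
  (\esum_(S in [set: n.-tuple X]) ((pmf_n p S)%:E * F S (tnth S k)) =
   \esum_(S in [set: n.-tuple X]) ((pmf_n p S)%:E *
     \esum_(x in [set: X]) ((p x)%:E * F (tuple_set S k x) x)))%E.
Proof.
move=> hp F0; have [p0 p1] := hp.
have pn0 S : 0 <= pmf_n p S by exact: pmf_n_ge0.
(* Multiplying by the total mass of [p] introduces the fresh sample x. *)
transitivity (\esum_(S in [set: n.-tuple X]) \esum_(x in [set: X])
   (((pmf_n p S)%:E * F S (tnth S k)) * (p x)%:E))%E.
  by apply: eq_esum => S _; rewrite esumZl ?p1 ?mule1// mule_ge0// lee_fin.
rewrite esum_esumT; last by move=> S x; rewrite !mule_ge0// lee_fin.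
pose swap (z : n.-tuple X * X) := (tuple_set z.1 k z.2, tnth z.1 k).
have swapK : involutive swap.
  by move=> [S x]; rewrite /swap tuple_set_tuple_set tnth_tuple_set eqxx.
rewrite (reindex_esum [set: n.-tuple X * X] _ swap); last first.
  split=> [//|y z _ _|z _]; first by move/(congr1 swap); rewrite !swapK.
  by exists (swap z); rewrite ?swapK.
transitivity (\esum_(S in [set: n.-tuple X]) \esum_(x in [set: X])
   ((pmf_n p S)%:E * ((p x)%:E * F (tuple_set S k x) x)))%E.
  rewrite esum_esumT; last by move=> S x; rewrite !mule_ge0// lee_fin.
  apply: eq_esum => -[S x] _ /=.
  by rewrite tnth_tuple_set eqxx muleAC -EFinM pmf_n_tuple_set EFinM muleA.
apply: eq_esum => S _; rewrite esumZl// ?lee_fin// => x.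
by rewrite mule_ge0// lee_fin.
Qed.

Lemma esum_pmf_n (R : realType) (X : choiceType) (p : X -> R) (n : nat) :
  is_pmf p -> \esum_(S in [set: n.-tuple X]) (pmf_n p S)%:E = 1%E.
Proof.
move=> hp; have [p0 p1] := hp; elim: n => [|n IH].
  rewrite (_ : [set: 0.-tuple X] = [set [tuple]]); last first.
    by apply/seteqP; split=> // S _ /=; rewrite tuple0.
  by rewrite esum_set1 /pmf_n ?big_ord0 ?lee_fin.
rewrite (reindex_esum [set: X * n.-tuple X] _ (fun z => [tuple of z.1 :: z.2])); last first.
  split=> //=.
  - by move=> [x S] [x' S'] _ _ /= [-> e]; congr pair; exact: val_inj.
  - move=> S _; exists (thead S, [tuple of behead S]) => //=.
    by rewrite -tuple_eta.
transitivity (\esum_(x in [set: X]) \esum_(S in [set: n.-tuple X])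
   ((p x)%:E * (pmf_n p S)%:E))%E.
  rewrite esum_esumT; last by move=> x S; rewrite mule_ge0// lee_fin ?pmf_n_ge0.
  apply: eq_esum => -[x S] _ /=; rewrite /pmf_n big_ord_recl -EFinM; congr (_ * _)%:E.
  by apply: eq_bigr => i _; rewrite tnthS.
rewrite -[RHS]p1; apply: eq_esum => x _.
rewrite esumZl ?IH ?mule1 ?lee_fin// => S.
by rewrite lee_fin pmf_n_ge0.
Qed.

(** * Expectation under the joint law of dataset and output *)

(** The expectation of F(S, A(S)) for S drawn from P^n, written as a sum of integrals, so that no
    joint measure has to be built. *)
Definition joint_mean d (T : measurableType d) (R : realType) (X : choiceType) (n : nat)
    (p : X -> R) (A : n.-tuple X -> probability T R) (F : n.-tuple X -> T -> R) : \bar R :=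
  (\esum_(S in [set: n.-tuple X]) ((pmf_n p S)%:E * \int[A S]_t (F S t)%:E))%E.

Definition nonneg_measurable d (T : measurableType d) (R : realType) (I : Type)
    (F : I -> T -> R) :=
  (forall i, measurable_fun [set: T] (F i)) /\ (forall i t, 0 <= F i t).

Lemma le_joint_mean d (T : measurableType d) (R : realType) (X : choiceType) (n : nat)
    (p : X -> R) (A : n.-tuple X -> probability T R) (F G : n.-tuple X -> T -> R) :
  is_pmf p -> nonneg_measurable F -> nonneg_measurable G ->
  (forall S t, F S t <= G S t) -> (joint_mean p A F <= joint_mean p A G)%E.
Proof.
move=> hp [mF F0] [mG G0] FG; apply: le_esum => S _.
apply: lee_wpmul2l; first by rewrite lee_fin pmf_n_ge0.
apply: ge0_le_integral => //= [t _|||t _]; rewrite ?lee_fin//; exact/measurable_EFinP.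
Qed.

Lemma joint_meanD d (T : measurableType d) (R : realType) (X : choiceType) (n : nat)
    (p : X -> R) (A : n.-tuple X -> probability T R) (F G : n.-tuple X -> T -> R) :
  is_pmf p -> nonneg_measurable F -> nonneg_measurable G ->
  joint_mean p A (fun S t => F S t + G S t) = (joint_mean p A F + joint_mean p A G)%E.
Proof.
move=> hp [mF F0] [mG G0]; have i0 H S : (forall S t, 0 <= H S t) ->
    (0 <= (pmf_n p S)%:E * \int[A S]_t (H S t)%:E)%E.
  move=> H0; rewrite mule_ge0 ?lee_fin ?pmf_n_ge0//.
  by apply: integral_ge0 => t _; rewrite lee_fin.
rewrite /joint_mean -esumD; do ?by move=> S _; exact: i0.
apply: eq_esum => S _; rewrite -ge0_muleDr; do ?by apply: integral_ge0 => t _; rewrite lee_fin.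
congr (_ * _)%E; rewrite -ge0_integralD//.
all: try by move=> t _; rewrite lee_fin.
all: exact/measurable_EFinP.
Qed.

Lemma joint_meanZ d (T : measurableType d) (R : realType) (X : choiceType) (n : nat)
    (p : X -> R) (A : n.-tuple X -> probability T R) (r : R) (F : n.-tuple X -> T -> R) :
  is_pmf p -> 0 <= r -> nonneg_measurable F ->
  joint_mean p A (fun S t => r * F S t) = (r%:E * joint_mean p A F)%E.
Proof.
move=> hp r0 [mF F0]; rewrite /joint_mean -esumZl ?lee_fin//; last first.
  move=> S; rewrite mule_ge0 ?lee_fin ?pmf_n_ge0//.
  by apply: integral_ge0 => t _; rewrite lee_fin.
apply: eq_esum => S _; rewrite muleCA; congr (_ * _)%E.
under eq_integral do rewrite EFinM.
rewrite ge0_integralZl_EFin//; first by move=> t _; rewrite lee_fin.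
exact/measurable_EFinP.
Qed.

Lemma joint_mean1 d (T : measurableType d) (R : realType) (X : choiceType) (n : nat)
    (p : X -> R) (A : n.-tuple X -> probability T R) :
  is_pmf p -> joint_mean p A (fun _ _ => 1) = 1%E.
Proof.
move=> hp; rewrite -[RHS](esum_pmf_n n hp); apply: eq_esum => S _.
by rewrite integral_cst//= probability_setT !mule1.
Qed.

(** * Differential privacy for expectations *)

(** The integral of a nonnegative function is monotone in the measure, here [mu] against [nu] scaled
    by exp(eps). *)
Lemma dp_integral d (T : measurableType d) (R : realType) (mu nu : probability T R)
    (eps : R) (f : T -> R) :
  (forall E, measurable E -> (mu E <= (expR eps)%:E * nu E)%E) ->
  measurable_fun [set: T] f -> (forall t, 0 <= f t) ->
  (\int[mu]_t (f t)%:E <= (expR eps)%:E * \int[nu]_t (f t)%:E)%E.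
Proof.
move=> mn mf f0; pose k := NngNum (expR_ge0 eps).
have -> : (expR eps)%:E = k%:num%:E by [].
rewrite -ge0_integral_mscale//; [|exact/measurable_EFinP|by move=> t _; rewrite lee_fin].
by apply: ge0_le_measure_integral => //; exact/measurable_EFinP.
Qed.

(** [eps_dp] over an arbitrary measurable output space. *)
Definition dp d (T : measurableType d) (R : realType) (X : Type) (n : nat)
    (A : n.-tuple X -> probability T R) (eps : R) :=
  forall S1 S2, Defs.adjacent S1 S2 ->
  forall E, measurable E -> (A S1 E <= (expR eps)%:E * A S2 E)%E.

Lemma adjacent_tuple_set (X : Type) (n : nat) (S : n.-tuple X) (k : 'I_n) (x : X) :
  Defs.adjacent S (tuple_set S k x).
Proof. by exists k => j /negPf jk; rewrite tnth_tuple_set jk. Qed.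

(** After resampling, the right side runs the algorithm on S with x in place k and evaluates [w] at
    x. Running it on S instead costs exp(eps) by privacy; the output is then independent of x, so
    averaging over x turns [w] into [wbar]. *)
Lemma dp_joint_mean d (T : measurableType d) (R : realType) (X : countType) (n : nat)
    (p : X -> R) (A : n.-tuple X -> probability T R) (eps : R) (k : 'I_n)
    (w : X -> T -> R) (wbar : T -> R) (H : n.-tuple X -> T -> R) :
  is_pmf p -> dp A eps -> nonneg_measurable w -> nonneg_measurable H ->
  (forall S x, H (tuple_set S k x) = H S) ->
  (forall t, \esum_(x in [set: X]) (p x * w x t)%:E = (wbar t)%:E) ->
  (joint_mean p A (fun S t => (wbar t * H S t)%R) <=
   (expR eps)%:E * joint_mean p A (fun S t => (w (tnth S k) t * H S t)%R))%E.
Proof.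
move=> hp dpA [mw w0] [mH H0] Hk hw; have [p0 p1] := hp.
have i0 S S' x : (0 <= \int[A S]_t (w x t * H S' t)%:E)%E.
  by apply: integral_ge0 => t _; rewrite lee_fin mulr_ge0.
rewrite /joint_mean.
rewrite (esum_resample k (F := fun S x => \int[A S]_t (w x t * H S t)%:E)%E)//.
rewrite -esumZl ?lee_fin ?expR_ge0//; last first.
  move=> S; rewrite mule_ge0 ?lee_fin ?pmf_n_ge0// esum_ge0// => x _.
  by rewrite mule_ge0 ?lee_fin.
apply: le_esum => S _; rewrite muleCA lee_wpmul2l ?lee_fin ?pmf_n_ge0//.
have -> : (\int[A S]_t (wbar t * H S t)%:E)%E =
    (\int[A S]_t (\esum_(x in [set: X]) (p x * (w x t * H S t))%:E))%E.
  apply: eq_integral => t _; rewrite mulrC EFinM -hw -esumZl ?lee_fin//.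
    by apply: eq_esum => x _; rewrite -EFinM; congr EFin; ring.
  by move=> x; rewrite lee_fin mulr_ge0.
rewrite integral_esum.
- rewrite -esumZl ?lee_fin ?expR_ge0//; last by move=> x; rewrite mule_ge0 ?lee_fin.
  apply: le_esum => x _; rewrite muleCA.
  under eq_integral do rewrite EFinM.
  rewrite ge0_integralZl_EFin//; last 2 first.
    by move=> t _; rewrite lee_fin mulr_ge0.
    by apply/measurable_EFinP; exact: measurable_funM.
  rewrite lee_wpmul2l ?lee_fin// Hk; apply: dp_integral.
  + exact/dpA/adjacent_tuple_set.
  + exact: measurable_funM.
  + by move=> t; rewrite mulr_ge0.
- move=> x; apply/measurable_EFinP; apply: measurable_funM => //.
  exact: measurable_funM.
- by move=> x t; rewrite lee_fin !mulr_ge0.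
Qed.

(** * Exponential moments, one record at a time *)

(** Up to the factor exp(-l q), both sides are separated by exp(l): the chord bound handles the
    left, the bound on m the right. The extra summands are those compared by privacy; adding them
    instead of subtracting keeps every integrand nonnegative. *)
Lemma tilted_moment_le (R : realType) (eps l v q : R) :
  0 <= eps -> 0 <= l <= 1 / 3 -> 0 <= v <= 1 -> 0 <= q <= 1 ->
  expR (l * (v - q)) + (expR l - 1) * ((1 - v) * expR (- (l * q))) <=
  expR (l * eps + 3 / 4 * l ^+ 2) +
  (expR l - 1) * (expR (- eps) * ((1 - q) * expR (- (l * q)))).
Proof.
move=> e0 /[dup] l13 /andP[l0 l3] v01 /andP[q0 q1].
have k0 : 0 <= expR l - 1 by rewrite subr_ge0 -expR0 ler_expR.
have k1 : expR l - 1 <= l + 3 / 4 * l ^+ 2 by have := expR_le_quadratic l13; lra.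
have hv := expR_chord l v01.
(* [m] is the worst mean of v(S_k) that privacy allows when its P-mean is [q]. *)
pose m := 1 - expR (- eps) * (1 - q).
have m0 : 0 <= m.
  rewrite subr_ge0 mulr_ile1 ?expR_ge0 ?subr_ge0 ?expR_le1 ?oppr_le0//; lra.
have m1 : m <= 1 by rewrite lerBlDr lerDl mulr_ge0 ?expR_ge0// subr_ge0.
(* By exp(-eps) >= 1 - eps, m is at most q + eps - eps q. *)
have mq : m <= q + eps.
  have : (1 - eps) * (1 - q) <= expR (- eps) * (1 - q).
    by rewrite ler_wpM2r ?subr_ge0//; exact: expR_ge1Dx.
  have : 0 <= eps * q by exact: mulr_ge0.
  by rewrite /m; lra.
(* After 1 + y <= exp(y), the linear part uses m <= q + eps and the quadratic part m <= 1. *)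
have hm : 1 + (expR l - 1) * m <= expR (l * eps + 3 / 4 * l ^+ 2) * expR (l * q).
  rewrite -expRD; apply: le_trans (expR_ge1Dx _) _; rewrite ler_expR.
  have : (expR l - 1) * m <= (l + 3 / 4 * l ^+ 2) * m by rewrite ler_wpM2r.
  have : l * m <= l * (q + eps) by rewrite ler_wpM2l.
  have : l ^+ 2 * m <= l ^+ 2 by rewrite ler_piMr ?sqr_ge0.
  by lra.
have eq0 : 0 < expR (- (l * q)) by exact: expR_gt0.
have ee : expR (l * q) * expR (- (l * q)) = 1 by rewrite -expRD subrr expR0.
rewrite mulrBr expRD.
have -> : expR (l * eps + 3 / 4 * l ^+ 2) =
    expR (l * eps + 3 / 4 * l ^+ 2) * expR (l * q) * expR (- (l * q)).
  by rewrite -[RHS]mulrA ee mulr1.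
rewrite (_ : _ + _ * _ = (expR (l * v) + (expR l - 1) * (1 - v)) * expR (- (l * q))); last by ring.
rewrite (_ : _ + _ * (_ * _) = (expR (l * eps + 3 / 4 * l ^+ 2) * expR (l * q) +
  (expR l - 1) * (expR (- eps) * (1 - q))) * expR (- (l * q))); last by ring.
by rewrite ler_pM2r//; rewrite /m in hm; lra.
Qed.

(** The pointwise bound is averaged with weight [G]; privacy for 1 - v then bounds the extra term on
    the right by the one on the left, and the two cancel. *)
Lemma exp_moment_step d (T : measurableType d) (R : realType) (X : countType) (n : nat)
    (p : X -> R) (A : n.-tuple X -> probability T R) (eps l : R) (k : 'I_n)
    (v : X -> T -> R) (q : T -> R) (G : n.-tuple X -> T -> R) :
  is_pmf p -> dp A eps -> 0 <= eps -> 0 <= l <= 1 / 3 ->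
  nonneg_measurable v -> (forall x t, v x t <= 1) ->
  measurable_fun [set: T] q ->
  (forall t, \esum_(x in [set: X]) (p x * v x t)%:E = (q t)%:E) ->
  nonneg_measurable G -> (forall S x, G (tuple_set S k x) = G S) ->
  joint_mean p A G \is a fin_num ->
  (joint_mean p A (fun S t => (expR (l * (v (tnth S k) t - q t)) * G S t)%R) <=
   (expR (l * eps + 3 / 4 * l ^+ 2))%:E * joint_mean p A G)%E.
Proof.
move=> hp dpA e0 l13 [mv v0] v1 mq hq [mG G0] Gk finG; have [p0 p1] := hp.
have /andP[l0 _] := l13.
have k0 : 0 <= expR l - 1 by rewrite subr_ge0 -expR0 ler_expR.
have hq' t : \esum_(x in [set: X]) (p x * (1 - v x t))%:E = (1 - q t)%:E.
  by apply: esum_onem => // x; rewrite v0 v1.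
have q0 t : 0 <= q t.
  by rewrite -lee_fin -hq esum_ge0// => x _; rewrite lee_fin mulr_ge0.
have q1 t : q t <= 1.
  rewrite -subr_ge0 -lee_fin -hq' esum_ge0// => x _.
  by rewrite lee_fin mulr_ge0 ?subr_ge0.
(* The added factor depends on the output only, so [H] ignores the k-th record as [G] does. *)
pose H S t := expR (- (l * q t)) * G S t.
have mexp : measurable_fun [set: T] (fun t => expR (- (l * q t))).
  by apply: measurableT_comp => //; apply: measurableT_comp => //; exact: measurable_funM.
have hH : nonneg_measurable H.
  split=> [S|S t]; last by rewrite mulr_ge0 ?expR_ge0.
  exact: (measurable_funM mexp (mG S)).
have hG : nonneg_measurable G by [].
have hw : nonneg_measurable (fun x t => 1 - v x t).
  by split=> [x|x t]; [exact: measurable_funB|rewrite subr_ge0].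
have hF1 : nonneg_measurable (fun S t => expR (l * (v (tnth S k) t - q t)) * G S t).
  split=> [S|S t]; last by rewrite mulr_ge0 ?expR_ge0.
  apply: measurable_funM => //; apply: measurableT_comp => //.
  by apply: measurable_funM => //; exact: measurable_funB.
have hF2 : nonneg_measurable (fun S t => (1 - v (tnth S k) t) * H S t).
  split=> [S|S t]; last by rewrite mulr_ge0 ?hH.2 ?subr_ge0.
  by apply: measurable_funM; [exact: hw.1|exact: hH.1].
have hF3 : nonneg_measurable (fun S t => (1 - q t) * H S t).
  split=> [S|S t]; last by rewrite mulr_ge0 ?hH.2 ?subr_ge0.
  by apply: measurable_funM; [exact: measurable_funB|exact: hH.1].
have hZ (r : R) (F : n.-tuple X -> T -> R) : 0 <= r -> nonneg_measurable F ->
    nonneg_measurable (fun S t => r * F S t).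
  move=> r0 [mF F0]; split=> [S|S t]; last exact: mulr_ge0.
  exact: measurable_funM.
have hD (F F' : n.-tuple X -> T -> R) : nonneg_measurable F -> nonneg_measurable F' ->
    nonneg_measurable (fun S t => F S t + F' S t).
  move=> [mF F0] [mF' F0']; split=> [S|S t]; last exact: addr_ge0.
  exact: measurable_funD.
have ek0 : 0 <= (expR l - 1) * expR (- eps) by rewrite mulr_ge0 ?expR_ge0.
have dpd := @dp_joint_mean _ _ _ _ _ p A eps k _ _ H hp dpA hw hH _ hq'.
have {}dpd : (joint_mean p A (fun S t => ((1 - q t) * H S t)%R) <=
   (expR eps)%:E * joint_mean p A (fun S t => ((1 - v (tnth S k) t) * H S t)%R))%E.
  by apply: dpd => S x; rewrite /H Gk.
set C := expR (l * eps + _).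
have C0 : 0 <= C by exact: expR_ge0.
have key : (joint_mean p A (fun S t => (expR (l * (v (tnth S k) t - q t)) * G S t)%R) +
   (expR l - 1)%:E * joint_mean p A (fun S t => ((1 - v (tnth S k) t) * H S t)%R) <=
   C%:E * joint_mean p A G +
   (expR l - 1)%:E * joint_mean p A (fun S t => ((1 - v (tnth S k) t) * H S t)%R))%E.
  apply: (@le_trans _ _ (C%:E * joint_mean p A G + ((expR l - 1) * expR (- eps))%:E *
     joint_mean p A (fun S t => ((1 - q t) * H S t)%R))%E).
    rewrite -!joint_meanZ// -!joint_meanD//; do ?by [exact: hZ].
    apply: le_joint_mean => //; do ?by [apply: hD => //; exact: hZ].
    move=> S t; rewrite /H.
    have v01 : 0 <= v (tnth S k) t <= 1 by rewrite v0 v1.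
    have q01 : 0 <= q t <= 1 by rewrite q0 q1.
    have := ler_wpM2r (G0 S t) (tilted_moment_le e0 l13 v01 q01).
    by rewrite -/C; lra.
  (* Privacy enters here, as [dpd] multiplied by exp(-eps). *)
  rewrite leeD2l// EFinM -muleA lee_wpmul2l ?lee_fin//.
  rewrite (le_trans (lee_wpmul2l _ dpd)) ?lee_fin ?expR_ge0//.
  by rewrite muleA -EFinM -expRD addNr expR0 mul1e.
rewrite leeD2rE in key => //.
(* The cancelled term is finite: (1 - v) exp(-l q) <= 1, so the mean of [G] dominates it. *)
rewrite fin_numM// ge0_fin_numE.
  apply: (le_lt_trans (y := joint_mean p A G)); last by rewrite ltey_eq finG.
  apply: le_joint_mean => // S t; rewrite /H mulrA ler_piMl//.
  rewrite mulr_ile1 ?subr_ge0 ?expR_ge0// ?lerBlDr ?lerDl//.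
  by rewrite expR_le1 oppr_le0 mulr_ge0.
apply: esum_ge0 => S _; rewrite mule_ge0 ?lee_fin ?pmf_n_ge0//.
by apply: integral_ge0 => t _; rewrite lee_fin hF2.2.
Qed.

(** Induction on the number of factors: the product over the first m records ignores record m
    (counted from 0), and its bound supplies the finiteness that the next step requires. *)
Lemma exp_moment_le d (T : measurableType d) (R : realType) (X : countType) (n : nat)
    (p : X -> R) (A : n.-tuple X -> probability T R) (eps l : R)
    (v : X -> T -> R) (q : T -> R) :
  is_pmf p -> dp A eps -> 0 <= eps -> 0 <= l <= 1 / 3 ->
  nonneg_measurable v -> (forall x t, v x t <= 1) ->
  measurable_fun [set: T] q ->
  (forall t, \esum_(x in [set: X]) (p x * v x t)%:E = (q t)%:E) ->
  (joint_mean p A (fun S t => (\prod_(i < n) expR (l * (v (tnth S i) t - q t)))%R) <=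
   (expR (n%:R * (l * eps + 3 / 4 * l ^+ 2)))%:E)%E.
Proof.
move=> hp dpA e0 l13 hv v1 mq hq.
pose e S t (i : 'I_n) := expR (l * (v (tnth S i) t - q t)).
(* Indices are filtered and the tuple is not shortened, since [A] takes exactly n records. *)
pose G (m : nat) S t := \prod_(i < n | (i < m)%N) e S t i.
have hG m : nonneg_measurable (G m).
  split=> [S|S t]; last by apply: prodr_ge0 => i _; exact: expR_ge0.
  rewrite /G; under eq_fun do rewrite -big_filter.
  apply: measurable_prod => i _; apply: measurableT_comp => //.
  by apply: measurable_funM => //; apply: measurable_funB => //; exact: hv.1.
suff H m : (m <= n)%N -> (joint_mean p A (G m) <=
    (expR (m%:R * (l * eps + 3 / 4 * l ^+ 2)))%:E)%E.
  have := H n (leqnn n); congr (joint_mean p A _ <= _)%E.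
  by apply/funext => S; apply/funext => t; apply: eq_bigl => i; rewrite ltn_ord.
elim: m => [_|m IH mn].
  rewrite mul0r expR0 (_ : G 0%N = (fun _ _ => 1)) ?joint_mean1//.
  by apply/funext => S; apply/funext => t; rewrite /G big_pred0.
have {}IH := IH (ltnW mn); pose k := Ordinal mn.
have -> : G m.+1 = fun S t => expR (l * (v (tnth S k) t - q t)) * G m S t.
  apply/funext => S; apply/funext => t; rewrite /G (bigD1 k)//=.
  congr (_ * _); apply: eq_bigl => i.
  by rewrite ltnS [in RHS]ltn_neqAle andbC -val_eqE.
have step : (joint_mean p A
    (fun S t => (expR (l * (v (tnth S k) t - q t)) * G m S t)%R) <=
    (expR (l * eps + 3 / 4 * l ^+ 2))%:E * joint_mean p A (G m))%E.
  apply: exp_moment_step => //.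
    move=> S x; apply/funext => t; apply: eq_bigr => i im.
    by rewrite /e tnth_tuple_set -val_eqE (ltn_eqF im).
  rewrite ge0_fin_numE ?(le_lt_trans IH) ?ltry//.
  apply: esum_ge0 => S _; rewrite mule_ge0 ?lee_fin ?pmf_n_ge0//.
  by apply: integral_ge0 => t _; rewrite lee_fin; exact: (hG m).2.
apply: (le_trans step).
rewrite (_ : m.+1%:R * _ = (l * eps + 3 / 4 * l ^+ 2) + m%:R * (l * eps + 3 / 4 * l ^+ 2)).
  by rewrite [in leRHS]expRD EFinM lee_wpmul2l// lee_fin expR_ge0.
by rewrite -natr1; ring.
Qed.

(** * Chernoff bound for one tail *)

Lemma measurable_sum_tail d (T : measurableType d) (R : realType) (X : Type) (n : nat)
    (v : X -> T -> R) (q : T -> R) (S : n.-tuple X) (c : R) :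
  (forall x, measurable_fun [set: T] (v x)) -> measurable_fun [set: T] q ->
  measurable [set t | c <= \sum_(i < n) (v (tnth S i) t - q t)].
Proof.
move=> mv mq; pose s t := \sum_(i < n) (v (tnth S i) t - q t).
have ms : measurable_fun [set: T] s.
  by apply: measurable_sum => i; exact: measurable_funB.
rewrite (_ : [set t | _] = s @^-1` `[c, +oo[%classic).
  by rewrite -[X in measurable X]setTI; apply: ms.
by apply/seteqP; split=> t /=; rewrite in_itv/= andbT.
Qed.

Lemma dp_upper_tail d (T : measurableType d) (R : realType) (X : countType) (n : nat)
    (p : X -> R) (A : n.-tuple X -> probability T R) (tau : R)
    (v : X -> T -> R) (q : T -> R) :
  is_pmf p -> dp A (tau / 2) -> 0 < tau <= 1 ->
  nonneg_measurable v -> (forall x t, v x t <= 1) ->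
  measurable_fun [set: T] q ->
  (forall t, \esum_(x in [set: X]) (p x * v x t)%:E = (q t)%:E) ->
  (\esum_(S in [set: n.-tuple X]) ((pmf_n p S)%:E *
     A S [set t | n%:R * tau <= \sum_(i < n) (v (tnth S i) t - q t)]%R) <=
   (expR (- (n%:R * tau ^+ 2 / 12)))%:E)%E.
Proof.
move=> hp dpA /andP[t0 t1] hv v1 mq hq.
(* This l minimises 3/4 l^2 - l tau/2, and tau <= 1 gives l <= 1/3. *)
pose l := tau / 3; have l0 : 0 <= l by rewrite /l; lra.
pose s S t := \sum_(i < n) (v (tnth S i) t - q t).
have ms S : measurable_fun [set: T] (s S).
  apply: measurable_sum => i; apply: measurable_funB => //; exact: hv.1.
have prodE S t : \prod_(i < n) expR (l * (v (tnth S i) t - q t)) = expR (l * s S t).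
  by rewrite /s mulr_sumr expR_sum.
set c := expR (- (l * (n%:R * tau))).
have hF : nonneg_measurable (fun S t => expR (l * s S t)).
  split=> [S|S t]; last exact: expR_ge0.
  by apply: measurableT_comp => //; exact: measurable_funM.
apply: (@le_trans _ _ (joint_mean p A (fun S t => c * expR (l * s S t)))).
  apply: le_esum => S _; rewrite lee_wpmul2l ?lee_fin ?pmf_n_ge0//.
  have mE := measurable_sum_tail S (n%:R * tau) hv.1 mq.
  rewrite -[X in A S X]setIT -integral_indic//.
  apply: ge0_le_integral => //.
  - exact/measurable_EFinP.
  - by apply/measurable_EFinP; apply: measurable_funM => //; exact: hF.1.
  (* Markov: the indicator of the tail is at most exp(l (s - n tau)). *)
  - move=> t _; rewrite lee_fin indicE; case: (boolP (_ \in _)) => [|_].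
      rewrite inE/= => h; rewrite -expRD -[leLHS]expR0 ler_expR addrC subr_ge0.
      exact: ler_wpM2l.
    by apply: mulr_ge0; exact: expR_ge0.
rewrite joint_meanZ ?expR_ge0//.
have moment : (joint_mean p A (fun S t => expR (l * s S t)) <=
    (expR (n%:R * (l * (tau / 2) + 3 / 4 * l ^+ 2)))%:E)%E.
  under eq_fun do under eq_fun do rewrite -prodE.
  by apply: exp_moment_le => //; rewrite /l; lra.
apply: (le_trans (lee_wpmul2l _ moment)); first by rewrite lee_fin expR_ge0.
(* Per record the exponent is -tau^2/3 + tau^2/6 + tau^2/12 = -tau^2/12. *)
by rewrite -EFinM -expRD lee_fin ler_expR /l; lra.
Qed.

(** * Measurability on the function space and almost sure events *)

Lemma measurable_eval (R : realType) (X : Type) (x : X) :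
  measurable_fun [set: funspace X R] (fun f : funspace X R => f x).
Proof.
move=> _ B mB; rewrite setTI.
by apply: sub_sigma_algebra; exists x, B.
Qed.

(** Outputs are [0,1]-valued only almost surely, while the tail bound asks for values in [0,1] at
    every point; clamping provides them. *)
Definition clamp (R : realType) (a : R) : R := Num.max 0 (Num.min 1 a).

Lemma clamp_itv (R : realType) (a : R) : 0 <= clamp a <= 1.
Proof. by rewrite /clamp le_max lexx ge_max ler01 ge_min lexx. Qed.

Lemma clamp_id (R : realType) (a : R) : 0 <= a <= 1 -> clamp a = a.
Proof. by move=> /andP[a0 a1]; rewrite /clamp (min_idPr a1) (max_idPr a0). Qed.

Lemma measurable_clamp_eval (R : realType) (X : Type) (x : X) :
  measurable_fun [set: funspace X R] (fun f : funspace X R => clamp (f x)).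
Proof.
apply: measurable_maxr => //; apply: measurable_minr => //.
exact: measurable_eval.
Qed.

Lemma measurable_pexp (R : realType) (X : countType) (p : X -> R) :
  measurable_fun [set: funspace X R] (fun f : funspace X R => pexp p f).
Proof.
apply: (measurableT_comp (fine_measurable measurableT)).
apply: measurable_fun_esum => x; apply/measurable_EFinP.
by apply: measurable_funM => //; exact: measurable_eval.
Qed.

(** A countable intersection over codes; a code of no element contributes [setT]. *)
Lemma measurable_unit_valued (R : realType) (X : countType) :
  measurable [set f : funspace X R | forall x, 0 <= f x <= 1].
Proof.
rewrite (_ : [set f | _] =
    \bigcap_(i in [set: nat]) oapp (fun x => [set f : funspace X R | 0 <= f x <= 1])
      setT (pickle_inv i)).
  apply: bigcap_measurableType => i _; case: (pickle_inv i) => //= x.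
  rewrite (_ : mkset _ = (fun f : funspace X R => f x) @^-1` `[0, 1]).
    by rewrite -[X in measurable X]setTI; exact: measurable_eval.
  by apply/seteqP; split => f /=; rewrite in_itv.
apply/seteqP; split=> [f f01 i _|f f01 x /=].
  by case: (pickle_inv i) => //= x; exact: f01.
by have := f01 (pickle x) I; rewrite pickleK_inv.
Qed.

(** A union bound with the inclusion checked only on an almost sure event; there clamped and
    original outputs agree. *)
Lemma probability_on_full d (T : measurableType d) (R : realType) (mu : probability T R)
    (G B C D : set T) :
  measurable G -> measurable B -> measurable C -> measurable D ->
  mu G = 1%E -> B `&` G `<=` C `|` D -> (mu B <= mu C + mu D)%E.
Proof.
move=> mG mB mC mD G1 BG.
have nG : mu (~` G) = 0%E.
  by rewrite probability_setC// G1 subee.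
have -> : mu B = mu (B `&` G).
  have mBG := measurableI _ _ mB mG.
  apply/eqP; rewrite eq_le (le_measure _ (mem_set mBG) (mem_set mB)) ?andbT; last first.
    by apply: subIsetl.
  rewrite -[X in (_ <= X)%E]adde0 -nG.
  apply: le_trans (measureU2 _ _ _) => //; last exact: measurableC.
  apply: le_measure; rewrite ?inE//; first by apply: measurableU => //; exact: measurableC.
  by move=> t Bt; have [Gt|Gt] := pselect (G t); [left|right].
apply: le_trans (measureU2 _ mC mD).
by apply: le_measure; rewrite ?inE//; [exact: measurableI|exact: measurableU].
Qed.

(** * Combination of the two tails *)

Theorem theorem3p2 (R : realType) (X : countType) (n : nat)
  (A : n.-tuple X -> probability (funspace X R) R) (eps : R) (p : X -> R)
  (beta tau : R) :
  eps_dp A eps ->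
  (forall S : n.-tuple X, A S [set f : funspace X R | forall x, 0 <= f x <= 1] = 1%E) ->
  is_pmf p ->
  0 < beta -> 0 < tau ->
  12 * ln (4 / beta) / tau ^+ 2 <= n%:R ->
  eps <= tau / 2 ->
  (\esum_(S in [set: n.-tuple X])
     ((pmf_n p S)%:E *
      A S [set phi : funspace X R | (tau < `|pexp p phi - emp_avg S phi|)%R]) <= beta%:E)%E.
Proof.
move=> dpA A01 hp b0 t0 hn et; have [p0 p1] := hp.
pose T := funspace X R.
(* Relaxing the privacy level to tau/2 fixes it at a positive value. *)
have dpT : dp A (tau / 2).
  move=> S1 S2 adj E mE; apply: (le_trans (dpA _ _ adj E mE)).
  by rewrite lee_wpmul2r// lee_fin ler_expR.
pose v (x : X) (f : T) := clamp (f x).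
have hv : nonneg_measurable v.
  split=> [x|x f]; first exact: measurable_clamp_eval.
  by have /andP[] := clamp_itv (f x).
have v1 x f : v x f <= 1 by have /andP[] := clamp_itv (f x).
pose q (f : T) := fine (\esum_(x in [set: X]) (p x * v x f)%:E).
have hq f : \esum_(x in [set: X]) (p x * v x f)%:E = (q f)%:E.
  rewrite fineK// ge0_fin_numE.
    apply: (@le_lt_trans _ _ 1%E); last exact: ltry.
    by rewrite -p1; apply: le_esum => x _; rewrite lee_fin ler_piMr.
  by apply: esum_ge0 => x _; rewrite lee_fin mulr_ge0// hv.2.
have mq : measurable_fun [set: T] q.
  apply: (measurableT_comp (fine_measurable measurableT)).
  apply: measurable_fun_esum => x.
  by apply/measurable_EFinP; apply: measurable_funM => //; exact: hv.1.
have hv' : nonneg_measurable (fun x f => 1 - v x f).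
  by split=> [x|x f]; [apply: measurable_funB => //; exact: hv.1|rewrite subr_ge0].
have v1' x f : 1 - v x f <= 1 by rewrite lerBlDr lerDl hv.2.
have mq' : measurable_fun [set: T] (fun f => 1 - q f) by exact: measurable_funB.
have hq' f : \esum_(x in [set: X]) (p x * (1 - v x f))%:E = (1 - q f)%:E.
  by apply: esum_onem => // x; rewrite hv.2 v1.
have pexpE (f : T) : (forall x, 0 <= f x <= 1) -> pexp p f = q f.
  by move=> f01; congr fine; apply: eq_esum => x _; rewrite /v clamp_id.
have empE (f : T) S : (forall x, 0 <= f x <= 1) ->
    emp_avg S f = n%:R^-1 * \sum_(i < n) v (tnth S i) f.
  by move=> f01; congr (_ * _); apply: eq_bigr => i _; rewrite /v clamp_id.
pose B (S : n.-tuple X) := [set f : T | tau < `|pexp p f - emp_avg S f|].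
have mB S : measurable (B S).
  have memp : measurable_fun [set: T] (fun f : T => emp_avg S f).
    apply: measurable_funM => //; apply: measurable_sum => i.
    exact: measurable_eval.
  rewrite (_ : B S = (fun f : T => `|pexp p f - emp_avg S f|) @^-1` `]tau, +oo[%classic).
    rewrite -[X in measurable X]setTI.
    have : measurable_fun [set: T] (fun f : T => `|pexp p f - emp_avg S f|).
      by apply: measurableT_comp => //; apply: measurable_funB => //; exact: measurable_pexp.
    by apply.
  by apply/seteqP; split => f; rewrite /B /= in_itv/= andbT.
(* [C] is the event that the empirical mean is too large; [D], the same event for 1 - v, that it is
   too small. *)
pose C (S : n.-tuple X) := [set f : T | n%:R * tau <= \sum_(i < n) (v (tnth S i) f - q f)].
pose D (S : n.-tuple X) := [set f : T | n%:R * tau <= \sum_(i < n) (1 - v (tnth S i) f - (1 - q f))].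
have q01 f : 0 <= q f <= 1.
  by apply/andP; split; [rewrite -lee_fin -hq|rewrite -subr_ge0 -lee_fin -hq'];
    apply: esum_ge0 => x _; rewrite lee_fin mulr_ge0 ?subr_ge0// hv.2.
have BCD S : B S `&` [set f : T | forall x, 0 <= f x <= 1] `<=` C S `|` D S.
  move=> f [/= Bf f01].
  (* For n = 0 the event [C] is the whole space, its inequality being 0 <= 0. *)
  case: (posnP n) => [n0|n0].
    left; rewrite /C /= big1 => [|i _]; first by rewrite n0 mul0r.
    by have : (i < 0)%N by rewrite -n0.
  have N0 : 0 < n%:R :> R by rewrite ltr0n.
  have sumB (a : R) (w : 'I_n -> R) : \sum_i (w i - a) = \sum_i w i - n%:R * a.
    by rewrite sumrB sumr_const card_ord mulr_natl.
  move: Bf; rewrite /B /= pexpE// empE// /C /D /= !sumB sumrB sumr_const card_ord.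
  set s := \sum_(i < n) _ => Bf.
  have {Bf} : n%:R * tau < `|n%:R * q f - s|.
    by rewrite -[X in _ - X](mulVKf (lt0r_neq0 N0)) -mulrBr normrM gtr0_norm// ltr_pM2l.
  rewrite ltr_normr => /orP[h|h]; [right|left]; rewrite /= -?[1 *+ n]/(n%:R); lra.
(* If tau > 1, two means in [0,1] cannot differ by more than tau, so the event is null. Otherwise
   the tail bound applies. *)
have [t1|t1] := leP tau 1; last first.
  rewrite esum1 ?lee_fin ?ltW// => S _.
  have BG : B S `&` [set f : T | forall x, 0 <= f x <= 1] `<=` set0 `|` set0.
    move=> f [+ f01]; rewrite /B /= pexpE// empE//.
    have s0 : 0 <= \sum_(i < n) v (tnth S i) f by apply: sumr_ge0 => i _; exact: hv.2.
    have s1 : \sum_(i < n) v (tnth S i) f <= n%:R.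
      rewrite -[X in _ <= X%:R](card_ord n) -sumr_const; exact: ler_sum.
    set a := _ * _ => Bf; exfalso.
    have a01 : 0 <= a <= 1.
      rewrite /a mulr_ge0 ?invr_ge0//= (le_trans (ler_wpM2l _ s1)) ?invr_ge0//.
      by have [->|N0] := eqVneq (n%:R : R) 0; rewrite ?mulr0// mulVf.
    have := q01 f; move: Bf; rewrite ltr_normr => /orP[]; lra.
  apply/eqP; rewrite eq_le mule_ge0 ?lee_fin ?pmf_n_ge0// andbT.
  have := probability_on_full (@measurable_unit_valued R X) (mB S) measurable0 measurable0 (A01 S) BG.
  rewrite measure0 adde0 => AB0.
  by rewrite mule_ge0_le0 ?lee_fin ?pmf_n_ge0.
apply: (@le_trans _ _ (\esum_(S in [set: n.-tuple X])
    ((pmf_n p S)%:E * A S (C S) + (pmf_n p S)%:E * A S (D S)))%E).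
  apply: le_esum => S _; rewrite -ge0_muleDr//.
  rewrite lee_wpmul2l ?lee_fin ?pmf_n_ge0//.
  exact: (probability_on_full (@measurable_unit_valued R X) (mB S) (measurable_sum_tail S (n%:R * tau) hv.1 mq)
    (measurable_sum_tail S (n%:R * tau) hv'.1 mq') (A01 S) (BCD S)).
rewrite esumD; do ?by move=> S _; rewrite mule_ge0// lee_fin pmf_n_ge0.
have t01 : 0 < tau <= 1 by rewrite t0.
apply: le_trans (leeD (dp_upper_tail hp dpT t01 hv v1 mq hq)
  (dp_upper_tail hp dpT t01 hv' v1' mq' hq')) _.
rewrite -EFinD lee_fin.
(* The lower bound on n gives beta/4 for each tail, hence beta/2 in total. *)
have : expR (- (n%:R * tau ^+ 2 / 12)) <= beta / 4.
  rewrite -[leRHS]lnK ?posrE ?divr_gt0// ler_expR -[beta / 4]invf_div lnV ?posrE ?divr_gt0//.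
  rewrite lerN2; move: hn; rewrite ler_pdivrMr ?exprn_gt0//; lra.
lra.
Qed.
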